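(* Let $r=\frac{\sqrt5+1}{2}$, let $K\ne 0$ be a real number, and let $f$ be the map on the cylinder $\mathbb{T}^1\times\mathbb{R}$ given by $f(\theta,P)=(\theta+2\pi r,\;P-K H'(\theta))$, where $H$ is the tent function. Let $v(\theta,P)=|P|$. Then for almost every $(\theta,P)\in\mathbb{T}^1\times\mathbb{R}$ the sequence $\{v(f^n(\theta,P))\}_{n\ge 0}$ is unbounded. In particular, there exists $y\in\mathbb{T}^1\times\mathbb{R}$ for which all $f^n(y)$, $n\geq 0$, are well defined and $\{v(f^n(y))\}_n$ is unbounded.
   Context: $\mathbb{T}^1=\mathbb{R}/2\pi\mathbb{Z}$. $H$ is the $2\pi$-periodic function with $H(\theta)=\theta-\frac{\pi}{2}$ for $0\le\theta\le\pi$ and $H(\theta)=\frac{3\pi}{2}-\theta$ for $\pi\le\theta\le 2\pi$; thus $H'(\theta)=1$ on $(0,\pi)$, $H'(\theta)=-1$ on $(\pi,2\pi)$, and $H'$ is undefined at $0$ and $\pi$ modulo $2\pi$. The map $f$ is defined at points with $\theta\not\equiv 0,\pi$ modulo $2\pi$. $f^n$ is the $n$-fold iterate, so where it is defined $f^n(\theta,P)=(\theta+2\pi n r,\;P-K\sum_{k=0}^{n-1}H'(\theta+2\pi k r))$. ''Almost every'' is with respect to Lebesgue measure. *)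

(* Defs.v *)
From HB Require Import structures.
From mathcomp Require Import all_boot all_order all_algebra.
From mathcomp Require Import generic_quotient ring_quotient archimedean.
From mathcomp Require Import all_classical all_reals all_analysis.

Set Implicit Arguments.
Unset Strict Implicit.
Unset Printing Implicit Defensive.

Import Order.TTheory GRing.Theory Num.Theory.
Import numFieldNormedType.Exports.

Local Open Scope classical_set_scope.
Local Open Scope ring_scope.
Local Open Scope quotient_scope.

Definition tau {R : realType} : R := pi *+ 2.

Section circle.
Variable R : realType.

(* 2 pi Z, so that [circle] below is the group R / 2 pi Z. *)
Definition tau_multiples : {pred R} := [pred x : R | x / tau \is a Num.int].

Lemma tau_multiples_zmod_closed : zmod_closed tau_multiples.
Proof.
split=> [|x y]; rewrite !inE ?mul0r ?rpred0// => xZ yZ.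
by rewrite mulrBl rpredB.
Qed.

HB.instance Definition _ :=
  GRing.isZmodClosed.Build R tau_multiples tau_multiples_zmod_closed.

Definition circle : Type := Quotient.quot tau_multiples.

HB.instance Definition _ := EqQuotient.on circle.
HB.instance Definition _ := GRing.Zmodule.on circle.
HB.instance Definition _ := isPointed.Build circle 0.

Definition to_circle : R -> circle := \pi_(circle).

(* The quotient sigma-algebra, which is the Borel sigma-algebra of the quotient
   topology: a set is measurable iff its preimage in R is a Borel set. *)
Definition circle_measurable : set (set circle) :=
  image_set_system [set: R] to_circle measurable.

Lemma circle_measurable_sigma : sigma_algebra [set: circle] circle_measurable.
Proof. exact/sigma_algebra_image/sigma_algebra_measurable. Qed.

Lemma circle_measurable0 : circle_measurable set0.
Proof. by case: circle_measurable_sigma. Qed.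

Lemma circle_measurableC A : circle_measurable A -> circle_measurable (~` A).
Proof. by case: circle_measurable_sigma => _ + _ => /[apply]; rewrite setTD. Qed.

Lemma circle_measurableU (F : (set circle)^nat) :
  (forall i, circle_measurable (F i)) -> circle_measurable (\bigcup_i F i).
Proof. by case: circle_measurable_sigma => _ _; exact. Qed.

HB.instance Definition _ := @isMeasurable.Build default_measure_display circle
  circle_measurable circle_measurable0 circle_measurableC circle_measurableU.

Lemma measurable_to_circle : measurable_fun [set: measurableTypeR R] to_circle.
Proof. by move=> _ A. Qed.

(* Lebesgue measure of total mass 2 pi: a set is measured by its lifts to the
   fundamental domain [0, 2 pi). *)
Definition circle_lebesgue : set circle -> \bar R :=
  pushforward (mrestr lebesgue_measure (measurable_itv `[0, tau[)) to_circle.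

Let circle_lebesgue0 : circle_lebesgue set0 = 0%E.
Proof. by rewrite /circle_lebesgue /pushforward preimage_set0 measure0. Qed.

Let circle_lebesgue_ge0 A : (0 <= circle_lebesgue A)%E.
Proof. exact: measure_ge0. Qed.

Let circle_lebesgue_sigma_additive : semi_sigma_additive circle_lebesgue.
Proof.
move=> F mF tF mUF; rewrite /circle_lebesgue /pushforward preimage_bigcup.
apply: measure_semi_sigma_additive.
- by move=> n; rewrite -[X in measurable X]setTI; exact: measurable_to_circle.
- apply/trivIsetP => /= i j _ _ ij; rewrite -preimage_setI.
  by move/trivIsetP : tF => /(_ _ _ _ _ ij) ->//; rewrite preimage_set0.
- rewrite -preimage_bigcup -[X in measurable X]setTI.
  exact: measurable_to_circle.
Qed.

HB.instance Definition _ := isMeasure.Build _ _ _ circle_lebesgue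
  circle_lebesgue0 circle_lebesgue_ge0 circle_lebesgue_sigma_additive.

End circle.

Arguments to_circle {R}.

Notation cylinder R := (circle R * R)%type.

(* [measurableTypeR R] is R with the Borel sets on which the library defines
   [lebesgue_measure]; the carrier is convertible to [cylinder R]. *)
Definition cylinder_lebesgue {R : realType} :
    set (circle R * measurableTypeR R) -> \bar R :=
  (@circle_lebesgue R \x @lebesgue_measure R)%E.

HB.instance Definition _ (R : realType) := Measure.on (@cylinder_lebesgue R).

Section map.
Variable R : realType.

(* [tent] is the 2 pi-periodic H, as a function on R; the inner difference is
   the representative of t in [0, 2 pi). *)
Definition tent (t : R) : R :=
  let s := t - tau * (Num.floor (t / tau))%:~R in
  if s <= pi then s - pi / 2 else 3 * pi / 2 - s.

(* H' as a function on the circle; by periodicity of [tent] the choice of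
   representative is immaterial. It is meaningful only off 0 and pi, where the
   library's total derivative takes a junk value. *)
Definition tent' (theta : circle R) : R := derive1 tent (repr theta).

(* The partial map f, undefined ([None]) where theta = 0 or pi mod 2 pi. *)
Definition tent_map (r K : R) (y : cylinder R) : option (cylinder R) :=
  if (y.1 == 0) || (y.1 == to_circle pi) then None
  else Some (y.1 + to_circle (tau * r), y.2 - K * tent' y.1).

Definition tent_iter (r K : R) (n : nat) (y : cylinder R) :
    option (cylinder R) :=
  iter n (obind (tent_map r K)) (Some y).

Definition height (y : cylinder R) : R := `|y.2|.

(* All f^n(y) are defined, z is the orbit, and v(f^n(y)) is unbounded. *)
Definition well_defined_unbounded_orbit (r K : R) (y : cylinder R) : Prop :=
  exists z : nat -> cylinder R,
    (forall n, tent_iter r K n y = Some (z n)) /\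
    ~ bounded_fun (fun n => height (z n)).

End map.

(* Main.v *)
Require Import Defs.
From mathcomp Require Import all_boot all_order all_algebra.
From mathcomp Require Import archimedean generic_quotient ring_quotient.
From mathcomp Require Import all_classical all_reals all_analysis.
From mathcomp Require Import lra ring zify.

Import Order.TTheory GRing.Theory Num.Theory.
Import numFieldNormedType.Exports.
Local Open Scope classical_set_scope.
Local Open Scope ring_scope.

(** Every orbit of the tent map that never meets a corner of the tent has
unbounded height; the other orbits start over countably many angles, which
form a null set. The rotation number enters through its irrationality.

In the coordinate x = theta / (2 pi), the height after n steps is |P - K a_n|,
where a_n = [wave_sum r x n] adds the values +1 or -1 of a square wave along
the rotation orbit x, x + r, x + 2 r, and so on. Two properties of the sums
a_n drive the proof: a_n has the parity of n ([wave_sum_parity]), and the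
change of a over the N steps that follow a visit to a point is the same for
all visits close enough to that point ([wave_sum_locally_constant]).

Suppose that a is bounded. For an arc I, let M(I) be the largest value that
a_n takes at arbitrarily late visits n of the orbit to I. These are integers
bounded below, so some arc I has the smallest M(I) = M. Take a late visit n to
I with a_n = M. As r is irrational, there is an odd N for which N r is so close
to an integer that n + N is a visit to I as well ([odd_return]). Then
a_(n+N) <= M, and by parity a_(n+N) < M. By local constancy, every late visit
to a small arc J around x + (n + N) r comes N steps after a visit to I where a
was at most M, and over these N steps a changes by the same negative amount
a_(n+N) - a_n. Hence M(J) < M, against the choice of I. This is
[wave_sum_unbounded]; in it the minimal arc is replaced by a descent on an
upper bound for M(I), which density of the orbit stops at the bottom. *)

Set Implicit Arguments.
Unset Strict Implicit.

(** * Density of irrational rotations *)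

Lemma irrational_neq_ratio (R : realType) (r : R) (n : nat) (m : int) :
  irrational r -> (0 < n)%N -> n%:R * r != m%:~R.
Proof.
move=> irr n0; apply/eqP => nr; apply: irr => /=.
exists (m%:~R / n%:R) => //.
rewrite fmorph_div /= ratr_int ratr_nat -nr mulrAC divff ?mul1r//.
by rewrite pnatr_eq0 -lt0n.
Qed.

(** Dirichlet's pigeonhole: of M + 1 multiples of [r], two have fractional
parts in the same of M equal boxes; irrationality keeps them apart. *)
Lemma small_multiple (R : realType) (r e : R) : irrational r -> 0 < e ->
  exists (q : nat) (p : int), 0 < `|q%:R * r - p%:~R| < e.
Proof.
move=> irr e0.
have [M M0 Me] : exists2 M : nat, (0 < M)%N & M%:R^-1 < e.
  exists (Num.truncn e^-1).+1 => //.
  rewrite invf_plt ?posrE//; exact: truncnS_gt.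
pose frac (i : nat) := i%:R * r - (Num.floor (i%:R * r))%:~R : R.
have frac_itv i : 0 <= frac i < 1.
  have := floor_itv (i%:R * r); rewrite intrD /frac; lra.
have MR : 0 < M%:R :> R by rewrite ltr0n.
have box_lt (i : 'I_M.+1) : (Num.truncn (M%:R * frac i) < M)%N.
  have /andP[f0 f1] := frac_itv i.
  by rewrite truncn_lt_nat ?mulr_ge0 ?ler0n// gtr_pMr.
pose box i := Ordinal (box_lt i).
have /injectivePn[i [j ij bij]] : ~~ injectiveb box.
  apply/negP => /injectiveP/leq_card; by rewrite !card_ord ltnn.
wlog lt_ij : i j ij bij / (i < j)%N.
  move=> H; have [/H|/H|/val_inj eij] := ltngtP i j; first exact.
    by apply; rewrite // eq_sym.
  by rewrite eij eqxx in ij.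
pose p := Num.floor (j%:R * r) - Num.floor (i%:R * r).
exists (j - i)%N, p.
have -> : (j - i)%:R * r - p%:~R = frac j - frac i.
  by rewrite natrB 1?ltnW// intrB /frac; ring.
apply/andP; split.
  rewrite normr_gt0 subr_eq0; apply/eqP => fji.
  have := @irrational_neq_ratio R r (j - i) p irr.
  rewrite subn_gt0 => /(_ lt_ij)/eqP; apply.
  rewrite natrB 1?ltnW// intrB; move: fji; rewrite /frac; lra.
apply: lt_trans Me.
have tr k : (box k : nat)%:R <= M%:R * frac k < (box k : nat)%:R + 1.
  have /andP[f0 _] := frac_itv k.
  by rewrite natr1 truncn_itv// mulr_ge0 ?ler0n.
have := tr i; have := tr j; rewrite bij => ti tj.
rewrite -(ltr_pM2l MR) divff ?gt_eqF// -(gtr0_norm MR) -normrM ltr_norml; lra.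
Qed.

(** Arcs of the circle R / Z, described on representatives in R. *)
Definition near_mod1 {R : realType} (c e x : R) : Prop :=
  exists m : int, `|x - c - m%:~R| < e.

(** Multiples of a small nonzero step d = q r - p follow each other at distance
|d| modulo 1, so that one of them is within |d| of any prescribed target. *)
Lemma orbit_dense (R : realType) (r x c e : R) (n0 : nat) :
  irrational r -> 0 < e ->
  exists2 n : nat, (n0 <= n)%N & near_mod1 c e (x + n%:R * r).
Proof.
move=> irr e0; have [q [p]] := small_multiple irr e0.
set d := _ - _ => /andP[d0 de].
pose c1 := c - x - n0%:R * r.
(* A representative of the target modulo 1 on the same side of 0 as d: it is
   then approached by nonnegative multiples of d. *)
have [m cd] : exists m : int, 0 <= (c1 - m%:~R) / d.
  have := floor_itv c1; rewrite intrD => c1f.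
  move: d0; rewrite normr_gt0 neq_lt => /orP[dn|dp].
    exists (Num.floor c1 + 1); rewrite ler_ndivlMr// mul0r intrD; lra.
  exists (Num.floor c1); rewrite divr_ge0//; [lra|exact: ltW].
pose k := Num.truncn ((c1 - m%:~R) / d).
exists (n0 + k * q)%N; first exact: leq_addr.
exists (k%:Z * p - m); apply: le_lt_trans de.
have -> : x + (n0 + k * q)%:R * r - c - (k%:Z * p - m)%:~R =
          (k%:R - (c1 - m%:~R) / d) * d.
  rewrite [RHS]mulrBl divfK; last by rewrite -normr_gt0.
  rewrite /c1 /d natrD natrM intrB intrM; ring.
rewrite normrM ger_pMl//.
have := truncn_itv cd; rewrite -/k.
rewrite -natr1 ler_norml; move: (_ / d) (k%:R) => s t; lra.
Qed.

(** The odd multiples r + n (2 r) of [r] form an orbit of the rotation by 2 r,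
which is irrational as well. *)
Lemma odd_return (R : realType) (r e : R) : irrational r -> 0 < e ->
  exists2 N : nat, odd N & near_mod1 0 e (N%:R * r).
Proof.
move=> irr e0; have irr2 : irrational (2 * r).
  move=> [s _ sr]; apply: irr; exists (s / 2) => //=.
  by rewrite fmorph_div /= sr ratr_nat mulrC mulKf ?pnatr_eq0.
have [n _ [m nm]] := @orbit_dense R (2 * r) r 0 e 0 irr2 e0.
exists n.*2.+1; first by rewrite /= odd_double.
exists m; rewrite (_ : _ * r = r + n%:R * (2 * r))//.
rewrite -muln2 -natr1 natrM; ring.
Qed.

(** * Sums of a square wave along a rotation *)

(** The slope of the tent, in the coordinate where the circle has length 1. *)
Definition square_wave {R : realType} (x : R) : int :=
  if x - (Num.floor x)%:~R < 1 / 2 then 1 else -1.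

Definition wave_sum {R : realType} (r x : R) (n : nat) : int :=
  \sum_(k < n) square_wave (x + k%:R * r).

Definition off_jumps {R : realType} (x : R) : Prop :=
  forall m : int, x != m%:~R / 2.

Lemma half_even (R : realType) (m : int) : (2 * m)%:~R / 2 = m%:~R :> R.
Proof. by rewrite intrM; lra. Qed.

Lemma half_odd (R : realType) (m : int) :
  (2 * m + 1)%:~R / 2 = m%:~R + 1 / 2 :> R.
Proof. by rewrite intrD intrM; lra. Qed.

Lemma square_wave_locally_constant (R : realType) (x : R) : off_jumps x ->
  exists2 e : R, 0 < e &
    forall y, near_mod1 x e y -> square_wave y = square_wave x.
Proof.
move=> xj; have := floor_itv x; rewrite intrD.
set k := Num.floor x => kx.
have fx : Num.floor x = k by [].
have x0 : x != k%:~R by have := xj (2 * k); rewrite half_even.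
have x1 : x != k%:~R + 1 / 2 by have := xj (2 * k + 1); rewrite half_odd.
have {x0}k0 : k%:~R < x by rewrite lt_neqAle eq_sym x0; lra.
move: x1; rewrite neq_lt => /orP[x1|x1].
  exists (Num.min (x - k%:~R) (k%:~R + 1 / 2 - x)).
    by rewrite lt_min; lra.
  move=> y [m]; rewrite lt_min !ltr_norml => ym.
  have fy : Num.floor y = k + m by apply: floor_def; rewrite !intrD; lra.
  by rewrite /square_wave fx fy !ifT// ?intrD; lra.
exists (Num.min (x - k%:~R - 1 / 2) (k%:~R + 1 - x)).
  by rewrite lt_min; lra.
move=> y [m]; rewrite lt_min !ltr_norml => ym.
have fy : Num.floor y = k + m by apply: floor_def; rewrite !intrD; lra.
by rewrite /square_wave fx fy !ifF//; apply/negbTE; rewrite -leNgt ?intrD; lra.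
Qed.

Lemma near_mod1_shift (R : realType) (c e x d : R) :
  near_mod1 c e x -> near_mod1 (c + d) e (x + d).
Proof. by move=> [m xm]; exists m; rewrite opprD addrACA subrr addr0. Qed.

Lemma near_mod1_le (R : realType) (c e e' x : R) :
  e <= e' -> near_mod1 c e x -> near_mod1 c e' x.
Proof. by move=> ee [m xm]; exists m; apply: lt_le_trans ee. Qed.

Lemma wave_sum_locally_constant (R : realType) (r x : R) (n : nat) :
  (forall k : nat, off_jumps (x + k%:R * r)) ->
  exists2 e : R, 0 < e &
    forall y, near_mod1 x e y -> wave_sum r y n = wave_sum r x n.
Proof.
move=> xj; elim: n => [|n [e1 e10 IH]].
  by exists 1 => // y _; rewrite /wave_sum !big_ord0.
have [e2 e20 step] := square_wave_locally_constant (xj n).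
exists (Num.min e1 e2) => [|y yx]; first by rewrite lt_min e10.
rewrite /wave_sum !big_ord_recr; congr (_ + _).
  by apply: IH; apply: near_mod1_le yx; rewrite ge_min lexx.
by apply/step/near_mod1_shift; apply: near_mod1_le yx; rewrite ge_min lexx orbT.
Qed.

Lemma wave_sumD (R : realType) (r x : R) (m n : nat) :
  wave_sum r x (m + n) = wave_sum r x m + wave_sum r (x + m%:R * r) n.
Proof.
rewrite /wave_sum big_split_ord; congr (_ + _).
by apply: eq_bigr => k _; rewrite natrD mulrDl addrA.
Qed.

Lemma wave_sum_parity (R : realType) (r x : R) (n : nat) :
  exists z : int, wave_sum r x n = n%:Z + 2 * z.
Proof.
elim: n => [|n [z IH]]; first by exists 0; rewrite /wave_sum big_ord0.
rewrite /wave_sum big_ord_recr /= -/(wave_sum r x n) IH /square_wave.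
by case: ifP => _; [exists z|exists (z - 1)]; lia.
Qed.

(** An integer sequence that changes by a fixed odd amount on returns to an arc
cannot stay at the top of its range there: the return shows a nearby arc on
which the top is lower, and this repeats until no value is left. *)
Lemma wave_sum_unbounded (R : realType) (r x : R) (C : nat) :
  irrational r -> (forall k : nat, off_jumps (x + k%:R * r)) ->
  exists n, (C%:Z < `|wave_sum r x n|).
Proof.
move=> irr xj; apply: contrapT => /forallNP bnd.
pose a n := wave_sum r x n.
have {}bnd n : - C%:Z <= a n <= C%:Z.
  by rewrite -ler_norml leNgt; apply/negP; exact: bnd.
(* Late visits to some arc satisfy a n < d - C: a bound on the shifted
   sequence a + C >= 0, so that d may be a natural number. *)
pose bounded_visits (d : nat) := exists (c e : R) (n0 : nat), 0 < e /\
  forall n, (n0 <= n)%N -> near_mod1 c e (x + n%:R * r) -> a n + C%:Z < d%:Z.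
have start : bounded_visits (C + C).+1.
  by exists 0, 1, 0%N; split=> // n _ _; have := bnd n; lia.
suff descent d : ~ bounded_visits d by exact: descent start.
elim: d => [[c [e [n0 [e0 low]]]]|d IH [c [e [n0 [e0 low]]]]].
  have [n n0n /(low _ n0n)] := orbit_dense x c n0 irr e0.
  by have := bnd n; lia.
apply: IH.
(* If late visits all miss the top value d of a + C, the arc itself already has
   the lower bound. *)
have [[n [n0n [m xm] an]]|nomax] := pselect (exists n, [/\ (n0 <= n)%N,
    near_mod1 c e (x + n%:R * r) & a n + C%:Z = d]); last first.
  exists c, e, n0; split=> // n n0n xn.
  have an : a n + C%:Z <> d by move=> an; apply: nomax; exists n.
  by have := low n n0n xn; lia.
(* The room left in the arc around x + n r. *)
pose g := e - `|x + n%:R * r - c - m%:~R|.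
have g0 : 0 < g by rewrite subr_gt0.
have [N oN [p Np]] := odd_return irr g0.
have xjn k : off_jumps (x + n%:R * r + k%:R * r).
  by rewrite -addrA -mulrDl -natrD; exact: xj.
have [e1 e10 const] := wave_sum_locally_constant N xjn.
have inside y s : `|y - (x + n%:R * r) - s%:~R| < g -> near_mod1 c e y.
  move=> ys; exists (m + s).
  have -> : y - c - (m + s)%:~R = (y - (x + n%:R * r) - s%:~R) +
      (x + n%:R * r - c - m%:~R) by rewrite intrD; ring.
  by apply: le_lt_trans (ler_normD _ _) _; rewrite -ltrBrDr.
(* The values at n and n + N differ in parity, so the latter is not the top. *)
have jump : a (n + N)%N + C%:Z < d.
  have /low lowN : (n0 <= n + N)%N by lia.
  have /lowN : near_mod1 c e (x + (n + N)%:R * r).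
    apply: (inside _ p); move: Np; rewrite subr0 natrD; congr (`|_| < _); ring.
  have [z1] := wave_sum_parity r x n; have [z2] := wave_sum_parity r x (n + N).
  rewrite -/(a n) -/(a (n + N)%N); lia.
(* After time n0 + N, a visit to the new arc is N steps after a visit to the old
   one that is itself late, whence the new threshold. *)
exists (x + n%:R * r + N%:R * r), (Num.min e1 g), (n0 + N)%N.
split=> [|j jN]; first by rewrite lt_min e10.
have -> : j = (j - N + N)%N by lia.
have {jN} : (n0 <= j - N)%N by lia.
move: (j - N)%N => {}j n0j /(near_mod1_shift (- (N%:R * r))).
rewrite addrK natrD mulrDl addrA addrK => nj.
have aj : a j + C%:Z <= a n + C%:Z.
  suff /(low _ n0j) : near_mod1 c e (x + j%:R * r) by lia.
  by case: nj => s; rewrite lt_min => /andP[_]; exact: inside.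
have : a (j + N)%N - a j = a (n + N)%N - a n.
  rewrite /a !wave_sumD !(addrAC _ _ (- _)) !subrr !add0r; apply: const.
  by apply: near_mod1_le nj; rewrite ge_min lexx.
by move: jump aj; lia.
Qed.

(** * The circle and the slope of the tent *)

Lemma tau_gt0 (R : realType) : 0 < tau :> R.
Proof. by rewrite /tau pmulrn_rgt0 ?pi_gt0. Qed.

Lemma pi_tau (R : realType) : pi = tau * (1 / 2) :> R.
Proof. by rewrite /tau mulr2n; lra. Qed.

Lemma to_circleP (R : realType) (s t : R) :
  to_circle s = to_circle t <-> exists m : int, s = t + tau * m%:~R.
Proof.
have t0 : tau != 0 :> R by rewrite gt_eqF ?tau_gt0.
rewrite (rwP eqP) /to_circle eqmodE /= Quotient.equivE inE /=.
split=> [/intrP[m stm]|[m ->]].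
  by exists m; rewrite -stm mulrC divfK// addrC subrK.
by rewrite addrAC subrr add0r mulrAC divff// mul1r.
Qed.

Lemma to_circleD (R : realType) (s t : R) :
  to_circle (s + t) = to_circle s + to_circle t.
Proof. by rewrite /to_circle raddfD. Qed.

Lemma square_waveDz (R : realType) (x : R) (m : int) :
  square_wave (x + m%:~R) = square_wave x.
Proof.
rewrite /square_wave floorDrz ?intr_int// intrKfloor intrD opprD addrACA subrr.
by rewrite addr0.
Qed.

(** Away from its corners the tent agrees, on a neighbourhood, with an affine
function of slope 1 or -1. *)
Lemma derive1_tent (R : realType) (x : R) : off_jumps x ->
  derive1 (@tent R) (tau * x) = (square_wave x)%:~R.
Proof.
move=> xj; have := floor_itv x; rewrite intrD.
set k := Num.floor x => kx.
have x0 : x != k%:~R by have := xj (2 * k); rewrite half_even.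
have x1 : x != k%:~R + 1 / 2 by have := xj (2 * k + 1); rewrite half_odd.
have {x0}k0 : k%:~R < x by rewrite lt_neqAle eq_sym x0; lra.
have t0 := tau_gt0 R; have tpi := pi_tau R.
have scale (u v : R) : (tau * u < tau * v) = (u < v) by rewrite ltr_pM2l.
have near_itv (a b : R) : a < x -> x < b ->
    \forall s \near tau * x, a < s / tau < b.
  move=> ax xb; near=> s; apply/andP; split.
    rewrite ltr_pdivlMr// mulrC; near: s.
    by apply: lt_nbhsr; rewrite scale.
  rewrite ltr_pdivrMr// [_ * tau]mulrC; near: s.
  by apply: lt_nbhsl; rewrite scale.
have fl (s : R) : k%:~R < s / tau < k%:~R + 1 -> Num.floor (s / tau) = k.
  by move=> sk; apply: floor_def; rewrite intrD; lra.
have sE (s : R) : s = tau * (s / tau) by rewrite mulrC divfK// gt_eqF.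
rewrite derive1E; move: x1; rewrite neq_lt => /orP[x1|x1].
  rewrite /square_wave ifT; last by lra.
  rewrite (@near_eq_derive _ _ _ _ (fun s => s - (tau * k%:~R + pi / 2))).
    by rewrite derive_val subr0.
  near=> s.
  have /andP[s1 s2] : k%:~R < s / tau < k%:~R + 1 / 2.
    by near: s; apply: near_itv.
  rewrite /tent fl; last by lra.
  rewrite ifT; first by rewrite opprD addrA.
  rewrite {1}(sE s) -mulrBr tpi ler_pM2l//; lra.
rewrite /square_wave ifF; last by apply/negbTE; rewrite -leNgt; lra.
rewrite (@near_eq_derive _ _ _ _ (fun s => (3 * pi / 2 + tau * k%:~R) - s)).
  by rewrite derive_val add0r mul1r.
near=> s.
have /andP[s1 s2] : k%:~R + 1 / 2 < s / tau < k%:~R + 1.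
  by near: s; apply: near_itv => //; lra.
rewrite /tent fl; last by lra.
rewrite ifF; first by rewrite opprB addrA.
apply/negbTE; rewrite -ltNge {1}(sE s) -mulrBr tpi ltr_pM2l//; lra.
Unshelve. all: by end_near.
Qed.

(** The representative chosen in [tent'] differs from [tau * x] by a multiple
of [tau], which neither the square wave nor its jumps see. *)
Lemma tent'_to_circle (R : realType) (x : R) : off_jumps x ->
  tent' (to_circle (tau * x)) = (square_wave x)%:~R.
Proof.
move=> xj; rewrite /tent'.
have /to_circleP[m ->] :
    to_circle (repr (to_circle (tau * x))) = to_circle (tau * x).
  exact: reprK.
rewrite -mulrDr derive1_tent ?square_waveDz// => n.
have := xj (n - 2 * m); apply: contra_neq => xm.
by rewrite intrB intrM mulrBl -xm mulrAC divff ?pnatr_eq0// mul1r addrK.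
Qed.

(** The jumps of the square wave are the corners of the tent, the two angles
where the map is undefined. *)
Lemma off_jumpsP (R : realType) (x : R) : off_jumps x <->
  to_circle (tau * x) <> 0 /\ to_circle (tau * x) <> to_circle pi.
Proof.
have t0 := tau_gt0 R; have t0' : tau != 0 :> R by rewrite gt_eqF.
have tpi := pi_tau R.
have -> : (0 : circle R) = to_circle 0 by rewrite /to_circle raddf0.
split=> [xj|[x0 x1] m].
  split=> /to_circleP[m].
    rewrite add0r => /(mulfI t0')xm; have /eqP := xj (2 * m); apply.
    by rewrite half_even.
  rewrite tpi -mulrDr => /(mulfI t0')xm; have /eqP := xj (2 * m + 1); apply.
  by rewrite half_odd addrC.
apply/eqP => xm.
have [z [mz|mz]] : exists z : int, m = 2 * z \/ m = 2 * z + 1.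
  by exists (m %/ 2)%Z; lia.
  by apply: x0; apply/to_circleP; exists z; rewrite xm mz add0r half_even.
apply: x1; apply/to_circleP; exists z.
by rewrite xm mz tpi -mulrDr half_odd addrC.
Qed.

(** * Orbits of the tent map *)

Lemma tent_iterE (R : realType) (r K x P : R) (n : nat) :
  (forall k : nat, off_jumps (x + k%:R * r)) ->
  tent_iter r K n (to_circle (tau * x), P) =
  Some (to_circle (tau * (x + n%:R * r)), P - K * (wave_sum r x n)%:~R).
Proof.
move=> xj; elim: n => [|n IH].
  by rewrite /wave_sum big_ord0 mulr0 subr0 mul0r addr0.
rewrite /tent_iter iterS -/(tent_iter r K n _) IH /= /tent_map /=.
have /off_jumpsP[/eqP/negbTE-> /eqP/negbTE->] /= := xj n.
rewrite tent'_to_circle// -to_circleD -mulrDr; congr (Some (to_circle _, _)).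
  by rewrite -natr1; ring.
by rewrite /wave_sum big_ord_recr /= intrD mulrDr opprD addrA.
Qed.

Lemma unbounded_orbit (R : realType) (r K x P : R) :
  irrational r -> K != 0 -> (forall k : nat, off_jumps (x + k%:R * r)) ->
  well_defined_unbounded_orbit r K (to_circle (tau * x), P).
Proof.
move=> irr K0 xj.
exists (fun n =>
  (to_circle (tau * (x + n%:R * r)), P - K * (wave_sum r x n)%:~R)).
split=> [n|]; first exact: tent_iterE.
case=> M [_ /(_ (M + 1))]; rewrite ltrDl ltr01 => /(_ isT) bnd.
pose B := (M + 1 + `|P|) / `|K|.
have [n big] := @wave_sum_unbounded R r x (Num.truncn B).+1 irr xj.
have {big} : B < `|(wave_sum r x n)%:~R|.
  apply: lt_trans (truncnS_gt B) _.
  by rewrite -intr_norm pmulrn ltr_int.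
rewrite /B ltr_pdivrMr ?normr_gt0// -normrM mulrC.
have := bnd n I; rewrite /= /height /= normr_id.
have := ler_normB P (P - K * (wave_sum r x n)%:~R).
rewrite opprB addrC subrK; lra.
Qed.

(** If the golden ratio is a / b then (2 a - b)^2 = 5 b^2, which contradicts the
parity of the exponent of 5 on both sides. *)
Lemma golden_ratio_irrational (R : realType) :
  irrational ((Num.sqrt 5 + 1) / 2 : R).
Proof.
move=> /rationalP[a [b rE]].
have b0 : b != 0%N.
  apply: contra_eq_neq rE => ->; rewrite invr0 mulr0 gt_eqF//.
have b0R : b%:R != 0 :> R by rewrite pnatr_eq0.
have : ((2 * a - b%:Z) ^+ 2)%:~R = (5 * b%:Z ^+ 2)%:~R :> R.
  have sq : Num.sqrt 5 * b%:R = 2 * a%:~R - b%:R :> R.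
    have {}rE : (Num.sqrt 5 + 1) / 2 * b%:R = a%:~R :> R by rewrite rE divfK.
    by rewrite -rE; lra.
  rewrite !expr2 !intrM intrB intrM -!pmulrn -sq mulrACA -expr2.
  by rewrite sqr_sqrtr.
move/intr_inj => /(congr1 absz); rewrite abszX abszM abszX.
rewrite (_ : `|5%R| = 5)%N//; move: (absz _) => c /(congr1 (logn 5)).
rewrite absz_nat lognX lognM ?expn_gt0 ?lt0n ?b0// lognX.
by rewrite (@logn_prime 5 5)//=; lia.
Qed.

(** * The exceptional null set *)

Definition singular_angles (R : realType) (r : R) : set (circle R) :=
  [set t | exists k : nat, t + to_circle (tau * (k%:R * r)) = 0 \/
                      t + to_circle (tau * (k%:R * r)) = to_circle pi].

Lemma nonsingular_off_jumps (R : realType) (r x : R) :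
  ~ singular_angles r (to_circle (tau * x)) ->
  forall k : nat, off_jumps (x + k%:R * r).
Proof.
move=> ns k; apply/off_jumpsP; rewrite mulrDr to_circleD.
by split=> tk; apply: ns; exists k; [left|right].
Qed.

Lemma countable_lift_singular (R : realType) (r : R) :
  countable (to_circle @^-1` singular_angles r).
Proof.
pose f (km : nat * int) : R := tau * (km.2%:~R / 2 - km.1%:R * r).
apply: (@sub_countable _ _ _ (f @` setT)); last first.
  exact: card_le_trans (card_image_le _ _) (countableP _).
apply: subset_card_le => t /=.
have t0 : tau != 0 :> R by rewrite gt_eqF ?tau_gt0.
have tE : t = tau * (t / tau) by rewrite mulrC divfK.
rewrite tE; move: (t / tau) => x [k].
rewrite -to_circleD -mulrDr => xk.
have [m xkm] : exists m : int, x + k%:R * r = m%:~R / 2.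
  apply: contrapT => /forallNP xj.
  have /off_jumpsP[x0 x1] : off_jumps (x + k%:R * r) by move=> m; apply/eqP.
  by case: xk.
exists (k, m) => //=; rewrite /f /= -xkm; congr (_ * _); ring.
Qed.

Lemma singular_negligible (R : realType) (r : R) :
  (@cylinder_lebesgue R).-negligible (singular_angles r `*` setT).
Proof.
have mS : measurable (singular_angles r).
  rewrite /measurable /= /circle_measurable /image_set_system /= setTI.
  apply: countable_measurable; last exact: countable_lift_singular.
  exact: measurable_set1.
exists (singular_angles r `*` setT); split => //; first exact: measurableX.
rewrite /cylinder_lebesgue product_measure1E//.
rewrite [X in (X * _)%E](_ : _ = 0)%E ?mul0e//.
apply: countable_lebesgue_measure0.
apply: sub_countable (countable_lift_singular r).
by apply: subset_card_le; exact: subIsetl.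
Qed.

(** A quarter turn: 1/4 is no multiple of 1/2, and 1/4 + k r is irrational for
k > 0. *)
Lemma quarter_off_jumps (R : realType) (r : R) : irrational r ->
  forall k : nat, off_jumps (1 / 4 + k%:R * r).
Proof.
move=> irr k m; apply/eqP => km.
have {}km : (4 * k)%:R * r = (2 * m - 1)%:~R.
  by rewrite natrM intrB intrM -mulrA -[k%:R * r](addKr (1 / 4)) km; lra.
case: k km => [|k]; last first.
  by move/eqP; apply/negP; apply: irrational_neq_ratio.
rewrite muln0 mul0r => /esym/eqP; rewrite intr_eq0 => /eqP; lia.
Qed.

Unset Implicit Arguments.
Set Strict Implicit.

Theorem corollary4p8 (R : realType) (K : R) (hK : K != 0) :
  let r : R := (Num.sqrt 5 + 1) / 2 in
  {ae @cylinder_lebesgue R, forall y,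
    well_defined_unbounded_orbit r K y} /\
  exists y : cylinder R, well_defined_unbounded_orbit r K y.
Proof.
move=> r; have irr : irrational r by exact: golden_ratio_irrational.
split; last first.
  exists (to_circle (tau * (1 / 4)), 0); apply: unbounded_orbit => //.
  exact: quarter_off_jumps.
apply: negligibleS (singular_negligible r) => -[theta P] /= bounded.
split=> //=; apply: contrapT => regular; apply: bounded.
have thetaE : theta = to_circle (tau * (repr theta / tau)).
  by rewrite mulrC divfK ?gt_eqF ?tau_gt0// /to_circle reprK.
rewrite thetaE in regular *; apply: unbounded_orbit => //.
exact: nonsingular_off_jumps.
Qed.
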